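(* Every $\mathcal{A}\mathrm{BD}$-algebra $(A,\cdot)$ is a nilalgebra with nilindex $3$, i.e. $(x\cdot x)\cdot x = x\cdot(x\cdot x)=0$ for all $x\in A$. In particular, every $\mathcal{A}\mathrm{BD}$-algebra is power associative.
   Context: All algebras are over $\mathbb{C}$; an algebra $(A,\cdot)$ is a vector space with a bilinear (not necessarily associative) multiplication. Write $x\circ y = x\cdot y+y\cdot x$. An algebra $(A,\cdot)$ is called an $\mathcal{A}\mathrm{BD}$-algebra (algebra of anti-biderivation-type) if for all $x,y,z\in A$: $x\cdot(y\circ z) = -\big((x\cdot y)\circ z+y\circ(x\cdot z)\big)$ and $(y\circ z)\cdot x=-\big((y\cdot x)\circ z+y\circ(z\cdot x)\big)$. An algebra is power associative if every subalgebra generated by one element is associative. *)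

(* Defs.v *)
From HB Require Import structures.
From mathcomp Require Import all_boot all_order all_algebra.
From mathcomp Require Import classical_sets reals.
From mathcomp Require Export complex.

Set Implicit Arguments.
Unset Strict Implicit.
Unset Printing Implicit Defensive.

Import GRing.Theory.
Local Open Scope classical_set_scope.
Local Open Scope ring_scope.

(* A non-associative algebra over K is a K-module A together with a product
   mul : {bilinear A -> A -> A}; the predicates below only use the underlying
   function of mul.  No unit, associativity or finite dimension is assumed. *)

Definition jprod (K : nzRingType) (A : lmodType K) (mul : A -> A -> A)
    (x y : A) : A :=
  mul x y + mul y x.

Definition ABD_algebra (K : nzRingType) (A : lmodType K)
    (mul : A -> A -> A) : Prop :=
  forall x y z : A,
    mul x (jprod mul y z)
      = - (jprod mul (mul x y) z + jprod mul y (mul x z)) /\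
    mul (jprod mul y z) x
      = - (jprod mul (mul y x) z + jprod mul y (mul z x)).

(* An upper bound: all cubes vanish, but squares are allowed to vanish too. *)
Definition nilalgebra3 (K : nzRingType) (A : lmodType K)
    (mul : A -> A -> A) : Prop :=
  forall x : A, mul (mul x x) x = 0 /\ mul x (mul x x) = 0.

Definition subalgebra (K : nzRingType) (A : lmodType K) (mul : A -> A -> A)
    (S : set A) : Prop :=
  submod_closed (mem S) /\ {in S &, forall u v, mul u v \in S}.

Definition generated_subalgebra (K : nzRingType) (A : lmodType K)
    (mul : A -> A -> A) (x : A) : set A :=
  smallest (subalgebra mul) [set x].

Definition power_associative (K : nzRingType) (A : lmodType K)
    (mul : A -> A -> A) : Prop :=
  forall x : A,
    {in generated_subalgebra mul x & &, associative mul}.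

(* Main.v *)
(** Taking [x = y = z], both identities have the same right-hand side, so
    [2 x(xx) = 2 (xx)x = -4 x(xx)] and the cubes vanish.  Taking [y = x] and
    [z = xx] then gives [(xx)(xx) = 0].  Hence the subalgebra generated by [x] is
    contained in the span of [x] and [xx], where every triple product is [0]. *)
Require Import Defs.
From HB Require Import structures.
From mathcomp Require Import all_boot all_order all_algebra.
From mathcomp Require Import classical_sets reals.

Local Open Scope ring_scope.
Import GRing.Theory Num.Theory.

(** The scalars have characteristic zero, so the integer factors produced by the identities can be
    cancelled. *)
Lemma lmod_mulrn_eq0 (K : numFieldType) (A : lmodType K) (v : A) (n : nat) :
  v *+ n.+1 = 0 -> v = 0.
Proof.
move/eqP; rewrite -scaler_nat scaler_eq0 pnatr_eq0 /=.
by move/eqP.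
Qed.

Section ABDAlgebra.

Context {K : numFieldType} {A : lmodType K} {mul : {bilinear A -> A -> A}}.
Context (ABD : ABD_algebra mul).

Lemma ABD_nilalgebra3 : nilalgebra3 mul.
Proof.
move=> x; have [EL ER] := ABD x x x.
move: EL ER; rewrite /jprod linearDr linearDl /=.
set L := mul x (mul x x); set r := mul (mul x x) x => EL ER.
have eqLr : L = r.
  apply/eqP; rewrite -subr_eq0; apply/eqP/(@lmod_mulrn_eq0 _ _ _ 1).
  by rewrite mulrnBl !mulr2n EL ER subrr.
suff L0 : L = 0 by rewrite -eqLr.
(* The index [5] encodes the factor 6 = 2 + 4: with [r = L], [EL] reads 2L = -4L. *)
apply: (@lmod_mulrn_eq0 _ _ _ 5); rewrite (mulrnDr L 2 4) mulr2n EL -eqLr.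
by rewrite -!mulr2n -mulrnA addNr.
Qed.

Lemma ABD_mul_sqr_sqr (x : A) : mul (mul x x) (mul x x) = 0.
Proof.
have [sqx xsq] := ABD_nilalgebra3 x.
(* Every term of [E] contains a cube of [x], except for two copies of the square of [mul x x]. *)
have [E _] := ABD x x (mul x x).
move: E; rewrite /jprod sqx xsq addr0 linear0r linear0l !addr0 => /esym/eqP.
by rewrite oppr_eq0 -mulr2n => /eqP/lmod_mulrn_eq0.
Qed.

(** The other three products in the expansion are the two cubes of [x] and the square of [mul x x],
    all zero. *)
Lemma ABD_mul_span_sqr (x : A) (a b c d : K) :
  mul (a *: x + b *: mul x x) (c *: x + d *: mul x x) = (a * c) *: mul x x.
Proof.
have [sqx xsq] := ABD_nilalgebra3 x.
rewrite linearDl !linearDr !linearZl_LR !linearZr_LR /=.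
by rewrite sqx xsq ABD_mul_sqr_sqr !scaler0 !addr0 scalerA.
Qed.

Lemma ABD_generated_subalgebra_span (x u : A) :
  u \in generated_subalgebra mul x ->
  exists a b : K, u = a *: x + b *: mul x x.
Proof.
(* [S] is a subalgebra containing [x], so minimality of the generated one applies. *)
pose S : set A := fun v => exists a b : K, v = a *: x + b *: mul x x.
rewrite inE => /(_ S); apply; split; last first.
  by move=> _ ->; exists 1, 0; rewrite scale1r scale0r addr0.
split; first split.
- by apply/mem_set; exists 0, 0; rewrite !scale0r addr0.
- move=> k _ _ /set_mem[a [b ->]] /set_mem[c [d ->]]; apply/mem_set.
  exists (k * a + c), (k * b + d).
  by rewrite scalerDr !scalerA !scalerDl addrACA.
move=> _ _ /set_mem[a [b ->]] /set_mem[c [d ->]]; apply/mem_set.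
by exists 0, (a * c); rewrite ABD_mul_span_sqr scale0r add0r.
Qed.

Lemma ABD_power_associative : power_associative mul.
Proof.
move=> x u v w /ABD_generated_subalgebra_span[a [b ->]].
move=> /ABD_generated_subalgebra_span[c [d ->]].
move=> /ABD_generated_subalgebra_span[e [f ->]].
(* Puts an inner product back in span form; its zero coefficient at [x] kills both triple
   products. *)
have sqE k : k *: mul x x = 0 *: x + k *: mul x x by rewrite scale0r add0r.
rewrite !ABD_mul_span_sqr (sqE (c * e)) (sqE (a * c)) !ABD_mul_span_sqr.
by rewrite mulr0 mul0r.
Qed.

End ABDAlgebra.

Theorem proposition11 (R : realType) (A : lmodType R[i])
    (mul : {bilinear A -> A -> A}) :
  ABD_algebra mul -> nilalgebra3 mul /\ power_associative mul.
Proof.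
by move=> ABD; split; [exact: ABD_nilalgebra3 | exact: ABD_power_associative].
Qed.
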